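(* Let $g:\mathbb R^n\to\mathbb R\cup\{+\infty\}$ be proper, lsc and convex, and let $\omega:\mathbb R^n\to\mathbb R$ be convex and continuously differentiable with Lipschitz gradient. If $\omega$ is 1-coercive, then the function $s_g:(x,\mu)\mapsto (g\#\omega_\mu)(x)$ is an epi-smoothing function for $g$ with $$\operatorname{gph}\nabla_x s_g(\cdot,\mu)\ \longrightarrow\ \operatorname{gph}\partial g\quad\text{as }\mu\downarrow0$$ (Painlevé–Kuratowski convergence), and hence, in particular, $$\operatorname*{Lim\,sup}_{\mu\downarrow 0,\,x\to\bar x}\nabla_x s_g(x,\mu)=\partial g(\bar x)\qquad\forall\,\bar x\in\operatorname{dom} g.$$
   Context: Lsc means lower semicontinuous; $\operatorname{dom} g=\{x\mid g(x)<+\infty\}$; proper means $\operatorname{dom} g\neq\emptyset$. For $\mu>0$, $\omega_\mu(y):=\mu\,\omega(y/\mu)$, and $(g\#\omega_\mu)(x):=\inf_{u\in\mathbb R^n}\{g(u)+\omega_\mu(x-u)\}$ (infimal convolution). $\omega$ is 1-coercive if $\lim_{\|x\|\to\infty}\omega(x)/\|x\|=+\infty$. $\partial g(\bar x)=\{v\mid g(x)\ge g(\bar x)+v^T(x-\bar x)\ \forall x\in\mathbb R^n\}$ for $\bar x\in\operatorname{dom}g$ (empty for $\bar x\notin \operatorname{dom} g$), and $\operatorname{gph}S=\{(x,y)\mid y\in S(x)\}$. The notation $\mu_k\downarrow0$ means $\mu_k>0$, $\mu_k\to0$. Set convergence: for a family $C_\mu\subset\mathbb R^p$ ($\mu>0$),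 $C_\mu\to C$ as $\mu\downarrow 0$ means that for every sequence $\mu_k\downarrow0$, every cluster point of any sequence $z^k\in C_{\mu_k}$ (taken along any subsequence) lies in $C$, and every $z\in C$ is the limit of some sequence $z^k\in C_{\mu_k}$. Epi-smoothing function: for $f:\mathbb R^n\to\mathbb R\cup\{+\infty\}$ lsc, $s_f:\mathbb R^n\times\mathbb R_+\to\mathbb R$ is an epi-smoothing function for $f$ if (i) for every $\mu_k\downarrow0$, $s_f(\cdot,\mu_k)$ epi-converges to $f$, i.e. for every $\bar x$: $\liminf_k s_f(x^k,\mu_k)\ge f(\bar x)$ for all $x^k\to\bar x$, and there is $x^k\to\bar x$ with $\limsup_k s_f(x^k,\mu_k)\le f(\bar x)$; and (ii) $s_f(\cdot,\mu)$ is (real-valued and) continuously differentiable for all $\mu>0$. Only values for $\mu>0$ matter; values at $\mu=0$ are irrelevant. $\operatorname*{Lim\,sup}_{\mu\downarrow 0,x\to\bar x}\nabla_xs_g(x,\mu)$ is the set of all $v$ for which there exist $x^k\to\bar x$ and $\mu_k\downarrow0$ with $\nabla_xs_g(x^k,\mu_k)\to v$. *)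

(* Defs.v *)
From HB Require Import structures.
From mathcomp Require Import all_boot all_order all_algebra.
From mathcomp Require Import all_classical all_reals all_analysis.
Set Implicit Arguments.
Unset Strict Implicit.
Unset Printing Implicit Defensive.
Import Order.TTheory GRing.Theory Num.Theory.
Import numFieldNormedType.Exports.
Local Open Scope classical_set_scope.
Local Open Scope ring_scope.

(* R^n is 'rV[R]_n.  The norm `|x| of the library on matrices is the sup norm,
   hence the explicit Euclidean norm; both induce the topology of 'rV[R]_n. *)
Definition dot (R : realType) (n : nat) (u v : 'rV[R]_n) : R :=
  \sum_(i < n) u ord0 i * v ord0 i.

Definition enorm (R : realType) (n : nat) (u : 'rV[R]_n) : R :=
  Num.sqrt (dot u u).

Definition grad (R : realType) (n : nat) (f : 'rV[R]_n -> R) (x : 'rV[R]_n) :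
    'rV[R]_n :=
  \row_(i < n) 'D_(delta_mx ord0 i) f x.

Definition C1 (R : realType) (n : nat) (f : 'rV[R]_n -> R) : Prop :=
  (forall x, differentiable f x) /\ continuous (grad f).

Definition lipschitz_grad (R : realType) (n : nat) (f : 'rV[R]_n -> R) : Prop :=
  exists L : R, forall x y, enorm (grad f x - grad f y) <= L * enorm (x - y).

Definition one_coercive (R : realType) (n : nat) (f : 'rV[R]_n -> R) : Prop :=
  forall A : R, exists r : R, forall x, r < enorm x -> A < f x / enorm x.

Definition dom (R : realType) (n : nat) (g : 'rV[R]_n -> \bar R) :
    set 'rV[R]_n :=
  [set x | (g x < +oo)%E].

(* The library's [convex_function] only covers real-valued functions.  At the
   endpoints, 0 * +oo = 0 in \bar R makes the inequality trivial. *)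
Definition econvex (R : realType) (n : nat) (g : 'rV[R]_n -> \bar R) : Prop :=
  forall (x y : 'rV[R]_n) (t : R), 0 <= t <= 1 ->
    (g (t *: x + (1 - t) *: y)%R <= t%:E * g x + (1 - t)%:E * g y)%E.

Definition subdiff (R : realType) (n : nat) (g : 'rV[R]_n -> \bar R)
    (xbar : 'rV[R]_n) : set 'rV[R]_n :=
  [set v | dom g xbar /\
           forall x, (g xbar + (dot v (x - xbar))%:E <= g x)%E].

Definition gph (X Y : Type) (S : X -> set Y) : set (X * Y) :=
  [set z | S z.1 z.2].

Definition epi_scale (R : realType) (n : nat) (om : 'rV[R]_n -> R) (mu : R)
    (y : 'rV[R]_n) : R :=
  mu * om (mu^-1 *: y).

Definition infconv (R : realType) (n : nat) (g h : 'rV[R]_n -> \bar R)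
    (x : 'rV[R]_n) : \bar R :=
  ereal_inf [set (g u + h (x - u)%R)%E | u in [set: 'rV[R]_n]].

Definition infconv_smoothing (R : realType) (n : nat)
    (g : 'rV[R]_n -> \bar R) (om : 'rV[R]_n -> R)
    (x : 'rV[R]_n) (mu : R) : \bar R :=
  infconv g (EFin \o epi_scale om mu) x.

Definition downto0 (R : realType) (mu : nat -> R) : Prop :=
  (forall k, 0 < mu k) /\ mu @ \oo --> (0 : R).

Definition epi_cvg (R : realType) (n : nat) (s : nat -> 'rV[R]_n -> \bar R)
    (f : 'rV[R]_n -> \bar R) : Prop :=
  forall xbar : 'rV[R]_n,
    (forall x : nat -> 'rV[R]_n, x @ \oo --> xbar ->
       (f xbar <= limn_einf (fun k => s k (x k)))%E) /\
    (exists x : nat -> 'rV[R]_n, x @ \oo --> xbar /\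
       (limn_esup (fun k => s k (x k)) <= f xbar)%E).

(* [s] takes extended values, so that an infimum can be plugged in; that it is
   real-valued for mu > 0 is part of the definition.  Values of [s] for
   mu <= 0 are never used. *)
Definition epi_smoothing (R : realType) (n : nat) (f : 'rV[R]_n -> \bar R)
    (s : 'rV[R]_n -> R -> \bar R) : Prop :=
  (forall mu : nat -> R, downto0 mu -> epi_cvg (fun k x => s x (mu k)) f) /\
  (forall mu : R, 0 < mu ->
     (forall x, s x mu \is a fin_num) /\ C1 (fun x => fine (s x mu))).

Definition grad_x (R : realType) (n : nat) (s : 'rV[R]_n -> R -> \bar R)
    (x : 'rV[R]_n) (mu : R) : 'rV[R]_n :=
  grad (fun y => fine (s y mu)) x.

(* Outer limit: points [z k] of C_(mu (phi k)) along a subsequence [phi]. *)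
Definition pk_cvg (R : realType) (T : topologicalType) (C : R -> set T)
    (D : set T) : Prop :=
  forall mu : nat -> R, downto0 mu ->
    (forall (phi : nat -> nat) (z : nat -> T), increasing_seq phi ->
       (forall k, C (mu (phi k)) (z k)) -> cluster (z @ \oo) `<=` D) /\
    (forall zbar, D zbar ->
       exists z : nat -> T, (forall k, C (mu k) (z k)) /\ z @ \oo --> zbar).

Definition Limsup_grad (R : realType) (n : nat) (s : 'rV[R]_n -> R -> \bar R)
    (xbar : 'rV[R]_n) : set 'rV[R]_n :=
  [set v | exists (x : nat -> 'rV[R]_n) (mu : nat -> R),
     [/\ x @ \oo --> xbar, downto0 mu &
         grad_x s (x k) (mu k) @[k --> \oo] --> v]].

(* Main.v *)
Require Import Defs.
From HB Require Import structures.
From mathcomp Require Import all_boot all_order all_algebra.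
From mathcomp Require Import all_classical all_reals all_analysis.
From mathcomp Require Import ring lra.
Set Implicit Arguments.
Unset Strict Implicit.
Unset Printing Implicit Defensive.
Import Order.TTheory GRing.Theory Num.Theory.
Import numFieldNormedType.Exports.
Local Open Scope classical_set_scope.
Local Open Scope ring_scope.

(** Write [s x mu] for the infimal convolution of [g] with the scaled kernel
    [y |-> mu * om (y / mu)], and [w] for the gradient of [om].

    A convex function with Lipschitz gradient has, at each point, a tangent
    that bounds it from below with a quadratic error ([quad_tangent]), and
    conversely a function with such tangents everywhere is continuously
    differentiable, with the tangent slopes as gradient ([quad_tangent_C1]).
    A convex lower semicontinuous [g] decreases at most linearly
    ([econvex_lsc_ge_affine_norm]) while [om] grows superlinearly, so the
    infimum that defines [s x mu] is attained at some [u].  The optimality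
    condition at [u] reads: [w ((x - u) / mu)] is a subgradient of [g] at [u]
    ([smoothing_prox]).  Adding that subgradient inequality to the tangent of
    the scaled kernel shows that [s _ mu] has at [x] a quadratic tangent of
    slope [w ((x - u) / mu)] ([infconv_quad_tangent]).  Hence [s _ mu] is
    continuously differentiable, and [v] is its gradient at [x] as soon as
    [v = w z] is a subgradient of [g] at [x - mu z] ([smoothing_grad]).

    The convergence of the graphs follows from this correspondence.  Every [v]
    is of the form [w z] because [om - dot v] has a minimizer; so if [v] is a
    subgradient of [g] at [x], the points [x + mu z] tend to [x] and have
    gradient exactly [v] ([smoothing_grad_inner]).  Conversely, if gradients
    [v_k] at [x_k] cluster at [v] and [x], the corresponding [z_k] are bounded
    by coercivity, so [x_k - mu_k z_k] clusters at [x] and the subgradient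
    inequality passes to the limit by lower semicontinuity
    ([smoothing_grad_outer]).

    For epi-convergence, the constant sequence is a recovery sequence, since
    [s x mu <= g x + mu * om 0]; the lower bound holds because superlinearity
    makes points far from [x] too expensive, uniformly for small [mu]
    ([smoothing_lower]). *)

(** * The dot product and the sup norm *)

Lemma dotC (R : realType) (n : nat) (u v : 'rV[R]_n) : dot u v = dot v u.
Proof. by apply: eq_bigr => i _; rewrite mulrC. Qed.

Lemma dotDl (R : realType) (n : nat) (u v w : 'rV[R]_n) :
  dot (u + v) w = dot u w + dot v w.
Proof. by rewrite -big_split; apply: eq_bigr => i _; rewrite mxE mulrDl. Qed.

Lemma dotZl (R : realType) (n : nat) (a : R) (u v : 'rV[R]_n) :
  dot (a *: u) v = a * dot u v.
Proof. by rewrite mulr_sumr; apply: eq_bigr => i _; rewrite mxE mulrA. Qed.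

Lemma dotNl (R : realType) (n : nat) (u v : 'rV[R]_n) : dot (- u) v = - dot u v.
Proof. by rewrite -scaleN1r dotZl mulN1r. Qed.

Lemma dotBl (R : realType) (n : nat) (u v w : 'rV[R]_n) :
  dot (u - v) w = dot u w - dot v w.
Proof. by rewrite dotDl dotNl. Qed.

Lemma dotDr (R : realType) (n : nat) (u v w : 'rV[R]_n) :
  dot u (v + w) = dot u v + dot u w.
Proof. by rewrite dotC dotDl !(dotC u). Qed.

Lemma dotZr (R : realType) (n : nat) (a : R) (u v : 'rV[R]_n) :
  dot u (a *: v) = a * dot u v.
Proof. by rewrite dotC dotZl (dotC u). Qed.

Lemma dotBr (R : realType) (n : nat) (u v w : 'rV[R]_n) :
  dot u (v - w) = dot u v - dot u w.
Proof. by rewrite dotC dotBl !(dotC u). Qed.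

Lemma normr_coord (R : realType) (n : nat) (u : 'rV[R]_n) (i : 'I_n) :
  `|u ord0 i| <= `|u|.
Proof.
rewrite [leRHS]mx_normrE.
exact: (le_bigmax _ (fun ij : 'I_1 * 'I_n => `|u ij.1 ij.2|) (ord0, i)).
Qed.

Lemma normr_le_coord (R : realType) (n : nat) (u : 'rV[R]_n) (M : R) :
  0 <= M -> (forall i, `|u ord0 i| <= M) -> `|u| <= M.
Proof.
move=> M0 uM; rewrite [leLHS]mx_normrE.
apply/bigmax_leP; split => // -[i j] _ /=.
by rewrite ord1.
Qed.

Lemma dot_le_norm (R : realType) (n : nat) (u v : 'rV[R]_n) :
  `|dot u v| <= n%:R * `|u| * `|v|.
Proof.
apply: le_trans (ler_norm_sum _ _ _) _.
apply: (@le_trans _ _ (\sum_(i < n) `|u| * `|v|)).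
  by apply: ler_sum => i _; rewrite normrM ler_pM ?normr_coord.
by rewrite sumr_const card_ord -mulrA mulr_natl.
Qed.

Lemma sqr_norm_le_dot (R : realType) (n : nat) (u : 'rV[R]_n) :
  `|u| ^+ 2 <= dot u u.
Proof.
have d0 : 0 <= dot u u by apply: sumr_ge0 => i _; exact: sqr_ge0.
rewrite -[leRHS]sqr_sqrtr // lerXn2r ?nnegrE ?sqrtr_ge0 //.
apply: normr_le_coord; rewrite ?sqrtr_ge0 // => i.
rewrite -sqrtr_sqr ler_wsqrtr // /dot (bigD1 i) //= expr2 lerDl.
by apply: sumr_ge0 => j _; exact: sqr_ge0.
Qed.

(** The hypotheses on the kernel are Euclidean, while the metric structure of
    row vectors comes from the sup norm; this bound and the next one transfer
    the former to the latter, so that the estimates can all be written in the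
    sup norm. *)
Lemma norm_le_enorm (R : realType) (n : nat) (u : 'rV[R]_n) : `|u| <= enorm u.
Proof.
by rewrite -[leLHS]normr_id -sqrtr_sqr ler_wsqrtr // sqr_norm_le_dot.
Qed.

Lemma enorm_le_norm (R : realType) (n : nat) (u : 'rV[R]_n) :
  enorm u <= Num.sqrt n%:R * `|u|.
Proof.
rewrite -[`|u|]normr_id -sqrtr_sqr -sqrtrM ?ler0n // ler_wsqrtr //.
by rewrite expr2 mulrA; exact: le_trans (ler_norm _) (dot_le_norm _ _).
Qed.

(** * Minimizers of lower semicontinuous functions *)

Lemma ereal_lt_between (R : realFieldType) (a b : \bar R) :
  (a < b)%E -> exists r : R, (a < r%:E < b)%E.
Proof.
case: a b => [a| |] [b| |] //=.
- by rewrite lte_fin => ab; exists ((a + b) / 2); rewrite !lte_fin; lra.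
- by move=> _; exists (a + 1); rewrite lte_fin ltry; lra.
- by move=> _; exists (b - 1); rewrite lte_fin ltNyr; lra.
- by move=> _; exists 0; rewrite ltNyr ltry.
Qed.

(** If the infimum [m] were not attained, the strict sublevel sets of [f] above
    [m] would form a filter on [K]; at a cluster point of it [f] exceeds some
    [r > m], hence also near that point, which a sublevel set contradicts. *)
Lemma lsc_argmin_compact (R : realType) (T : topologicalType) (f : T -> \bar R)
    (K : set T) :
  lower_semicontinuous f -> compact K -> K !=set0 ->
  exists2 p, K p & forall x, K x -> (f p <= f x)%E.
Proof.
move=> lf cK [x0 Kx0].
set m := ereal_inf (f @` K).
have [minK|nm] := pselect (exists2 p, K p & f p = m).
  case: minK => p Kp fp; exists p => // x Kx; rewrite fp.
  by apply: ereal_inf_lbound; exists x.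
have mlt x : K x -> (m < f x)%E.
  move=> Kx; rewrite lt_neqAle ereal_inf_lbound ?andbT; last by exists x.
  by apply/eqP => mfx; apply: nm; exists x.
pose G := filter_from [set a : \bar R | (m < a)%E]
                      (fun a => K `&` [set x | (f x < a)%E]).
have PG : ProperFilter G.
  apply: filter_from_proper; first apply: filter_from_filter.
  - by exists (f x0); exact: mlt.
  - move=> a b ma mb; exists (Order.min a b); first by rewrite /= lt_min ma mb.
    by move=> x [Kx]; rewrite /= lt_min => /andP[? ?].
  - by move=> a /ereal_inf_lt[_ [x Kx <-] fxa]; exists x.
have GK : G K by exists (f x0); [exact: mlt | move=> x []].
have [p [Kp clp]] := cK G PG GK.
have [r /andP[mr rp]] := ereal_lt_between (mlt _ Kp).
have [V Vp fV] := lf p r rp.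
have Gr : G (K `&` [set x | (f x < r%:E)%E]) by exists r%:E.
have [x [[_ fxr] Vx]] := clp _ _ Gr Vp.
by have := lt_trans fxr (fV x Vx); rewrite ltxx.
Qed.

Lemma compact_closed_ball_rV (R : realType) (n : nat) (x : 'rV[R]_n) (r : R) :
  compact (closed_ball_ Num.norm x r).
Proof.
apply: bounded_closed_compact; last exact: closed_closed_ball_.
exists (`|x| + r); split; first exact: num_real.
move=> M Mr y /= yx; apply/ltW/(le_lt_trans _ Mr).
rewrite -[y](subrKC x); apply: le_trans (ler_normD _ _) _.
by rewrite lerD2l distrC.
Qed.

Lemma lsc_argmin (R : realType) (n : nat) (f : 'rV[R]_n -> \bar R)
    (x0 : 'rV[R]_n) (r : R) :
  lower_semicontinuous f -> (forall x, r < `|x| -> (f x0 <= f x)%E) ->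
  exists p, forall x, (f p <= f x)%E.
Proof.
move=> lf fr; pose s := Num.max r `|x0|.
have K0 : closed_ball_ Num.norm (0 : 'rV[R]_n) s x0.
  by rewrite /closed_ball_ /= sub0r normrN le_max lexx orbT.
have cK := @compact_closed_ball_rV R n 0 s.
have [p Kp minp] := lsc_argmin_compact lf cK (ex_intro _ x0 K0).
exists p => x; have [xs|xs] := leP `|x| s.
  by apply: minp; rewrite /closed_ball_ /= sub0r normrN.
apply: le_trans (minp _ K0) _; apply: fr; apply: le_lt_trans xs.
by rewrite le_max lexx.
Qed.

Lemma lsc_addr (R : realType) (T : topologicalType) (f : T -> \bar R)
    (h : T -> R) :
  lower_semicontinuous f -> continuous h ->
  lower_semicontinuous (fun x => (f x + (h x)%:E)%E).
Proof.
move=> lf ch x a; rewrite -lteBlDr // -EFinB => afx.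
have [r /andP[ar rf]] := ereal_lt_between afx.
have [V Vx fV] := lf _ _ rf.
exists (V `&` [set y | h x - h y < r - (a - h x)]); last first.
  move=> y [Vy /= hy]; rewrite -lteBlDr //; apply: le_lt_trans (fV _ Vy).
  by rewrite -EFinB lee_fin; lra.
apply: filterI => //.
have e0 : 0 < r - (a - h x) by rewrite subr_gt0 -lte_fin.
have /cvgrPdist_lt /(_ _ e0) := ch x.
by apply: filterS => y; apply: le_lt_trans; exact: ler_norm.
Qed.

(** * Differentiability of real functions of a row vector *)

Lemma lipschitz_continuous (R : realType) (V W : normedModType R) (f : V -> W)
    (k : R) :
  (forall x y, `|f x - f y| <= k * `|x - y|) -> continuous f.
Proof.
move=> fk x; apply/cvgrPdist_le => e e0.
have k0 : 0 < `|k| + 1 by rewrite ltr_wpDl.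
have := @cvgrPdist_le _ _ _ (nbhs x) _ id x.
move=> [/(_ cvg_id) /(_ (e / (`|k| + 1)) (divr_gt0 e0 k0)) + _].
apply: filterS => y /= xy; apply: le_trans (fk _ _) _.
have -> : e = (`|k| + 1) * (e / (`|k| + 1)) by rewrite mulrC divfK // gt_eqF.
apply: (@le_trans _ _ ((`|k| + 1) * `|x - y|)); last by rewrite ler_pM2l.
by rewrite ler_wpM2r // (le_trans (ler_norm k)) // lerDl.
Qed.

(** The differential is defined by a choice among the continuous linear maps
    that approximate [f] to first order; exhibiting one suffices, and it is
    then the differential because such a map is unique. *)
Lemma differentiable_approx (R : realType) (V W : normedModType R) (f : V -> W)
    (df : {linear V -> W}) (x : V) :
  continuous df ->
  (forall e, 0 < e ->
     \forall h \near (0 : V), `|f (h + x) - (f x + df h)| <= e * `|h|) ->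
  differentiable f x /\ 'd f x = df :> (V -> W).
Proof.
move=> dfc dfe.
have dfo : f \o shift x = cst (f x) + df +o_ 0 id by apply/eqaddoP.
split; last exact: diff_unique.
apply/diffP => /=.
apply: (@getPex _ (fun (df : {linear V -> W}) => continuous df /\
  forall y, f y = f (lim (nbhs x)) + df (y - lim (nbhs x))
                  +o_(y \near x) (y - lim (nbhs x)))).
exists df; split => // z; rewrite lim_id //.
have dfx : f = (fun y => f x + df (y - x)) +o_x (fun y => y - x).
  apply/eqaddoP => e e0; rewrite [\forall x \near _, _ <= _](near_shift 0).
  have := dfe _ e0; apply: filterS => h /=.
  by rewrite !fctE /= subr0 addrK.
exact: (congr1 (@^~ z) dfx).
Qed.

Fact dot_is_linear (R : realType) (n : nat) (v : 'rV[R]_n) :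
  linear (dot v : 'rV[R]_n -> R^o).
Proof. by move=> a x y; rewrite dotDr dotZr. Qed.

HB.instance Definition _ (R : realType) (n : nat) (v : 'rV[R]_n) :=
  GRing.isLinear.Build R 'rV[R]_n R^o *:%R (dot v) (dot_is_linear v).

Lemma dot_continuous (R : realType) (n : nat) (v : 'rV[R]_n) :
  continuous (dot v).
Proof.
apply: (@lipschitz_continuous _ _ _ _ (n%:R * `|v|)) => x y.
by rewrite -dotBr dot_le_norm.
Qed.

Lemma dot_grad (R : realType) (n : nat) (f : 'rV[R]_n -> R) (x h : 'rV[R]_n) :
  differentiable f x -> dot (grad f x) h = 'd f x h.
Proof.
move=> dfx; rewrite [in RHS](row_sum_delta h) linear_sum.
by apply: eq_bigr => i _; rewrite linearZ /= mxE deriveE // mulrC.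
Qed.

Lemma grad_of_diff (R : realType) (n : nat) (f : 'rV[R]_n -> R)
    (x v : 'rV[R]_n) :
  differentiable f x -> 'd f x = dot v :> ('rV[R]_n -> R) -> grad f x = v.
Proof.
move=> dfx dv; apply/rowP => i; rewrite mxE deriveE // dv /dot.
rewrite (bigD1 i) //= big1 ?addr0 ?mxE ?eqxx ?mulr1 // => j ji.
by rewrite mxE (negPf ji) andbF mulr0.
Qed.

Lemma near0_small_scale (R : realType) (n : nat) (P : set 'rV[R]_n)
    (h : 'rV[R]_n) :
  nbhs (0 : 'rV[R]_n) P -> exists2 t : R, 0 < t <= 1 & P (t *: h).
Proof.
move=> P0.
have ht : t *: h @[t --> (0 : R)^'+] --> (0 : 'rV[R]_n).
  apply: cvg_at_right_filter; rewrite -[X in _ --> X](scale0r h).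
  by apply: cvgZr_tmp; exact: cvg_id.
have : \forall t \near (0 : R)^'+, [/\ 0 < t, t <= 1 & P (t *: h)].
  near=> t; split.
  - by near: t; exact: nbhs_right_gt.
  - by near: t; exact: nbhs_right_le.
  - by near: t; exact: ht.
by move=> /filter_ex[t [t0 t1 Pt]]; exists t => //; rewrite t0.
Unshelve. all: by end_near. Qed.

(** On the segment from [x] to [y], the convexity bound and the first-order
    expansion at [x] are compared at parameter [t] and divided by [t]; the
    error is an arbitrarily small multiple of [`|y - x|]. *)
Lemma convex_ge_tangent (R : realType) (n : nat) (f : 'rV[R]_n -> R)
    (x y : 'rV[R]_n) :
  convex_function [set: 'rV[R]_n] f -> differentiable f x ->
  f x + dot (grad f x) (y - x) <= f y.
Proof.
move=> cf dfx; set h := y - x; apply/ler_addgt0Pr => e e0.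
have h1 : 0 < `|h| + 1 by rewrite ltr_wpDl.
have /eqaddoP /(_ _ (divr_gt0 e0 h1)) := diff_locally dfx.
move=> /(near0_small_scale h)[t /andP[t0 t1]] /=; rewrite !fctE /=.
rewrite linearZ /= -dot_grad // normrZ gtr0_norm //.
have := cf (Itv01 (ltW t0) t1) y x (mem_setT _) (mem_setT _).
rewrite convRE /conv /= /unstable.onem.
have -> : t *: y + (1 - t) *: x = t *: h + x.
  by rewrite /h scalerBr scalerBl scale1r addrA addrAC.
rewrite -[t *: dot _ _]/(t * dot _ _) ler_norml => fth /andP[dth _].
have eh : e / (`|h| + 1) * `|h| <= e.
  by rewrite mulrAC ler_pdivrMr // ler_pM2l // lerDl.
rewrite -(ler_pM2l t0); have := ler_wpM2l (ltW t0) eh.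
by nra.
Qed.

(** * Functions with a quadratic tangent *)

(** The two bounds say that [v] is a subgradient of [f] at [x] and that the
    tangent there is accurate up to a quadratic error.  For a convex function
    this for all [x], with a common [c], is another way to say that the
    gradient is Lipschitz; unlike a statement about gradients it passes
    directly from a kernel to an infimal convolution. *)
Definition quad_tangent (R : realType) (n : nat) (c : R) (f : 'rV[R]_n -> R)
    (x v : 'rV[R]_n) : Prop :=
  forall y, 0 <= f y - f x - dot v (y - x) <= c * `|y - x| ^+ 2.

Lemma quad_tangent_grad (R : realType) (n : nat) (f : 'rV[R]_n -> R)
    (x v : 'rV[R]_n) (c : R) : 0 < c ->
  quad_tangent c f x v ->
  differentiable f x /\ grad f x = v.
Proof.
move=> c0 pf.
have [|dfx dv] := @differentiable_approx R _ _ f (dot v) x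
    (@dot_continuous R n v).
  move=> e e0; near=> h.
  have /andP[p0 pc] := pf (h + x); rewrite addrK in p0 pc.
  rewrite opprD addrA ger0_norm //; apply: le_trans pc _.
  rewrite expr2 mulrA; apply: ler_wpM2r => //; rewrite mulrC -ler_pdivlMr //.
  by near: h; apply: (@nbhs0_le R 'rV[R]_n); exact: divr_gt0.
by split => //; exact: grad_of_diff.
Unshelve. all: by end_near. Qed.

(** The lower bound of the tangent at [x] and the upper bound of the tangent at
    [y] are compared at the point [z]; the step [t] along [v x - v y] is the
    one for which the linear gain beats the quadratic loss the most. *)
Lemma quad_tangent_lipschitz (R : realType) (n : nat) (f : 'rV[R]_n -> R)
    (v : 'rV[R]_n -> 'rV[R]_n) (c : R) : 0 < c ->
  (forall x, quad_tangent c f x (v x)) ->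
  forall x y, `|v x - v y| <= 2 * c * `|x - y|.
Proof.
move=> c0 pf x y; set d := v x - v y; pose t := (2 * c)^-1.
have t0 : 0 < t by rewrite invr_gt0 mulr_gt0.
pose z := y + t *: d.
have /andP[xz _] := pf x z; have /andP[_ yz] := pf y z.
have /andP[_ xy] := pf x y.
have zy : z - y = t *: d by rewrite /z addrC addKr.
have zx : z - x = t *: d + (y - x) by rewrite -zy addrA subrK.
rewrite zx dotDr !dotZr in xz; rewrite zy dotZr normrZ gtr0_norm // in yz.
have dd : `|d| ^+ 2 <= dot (v x) d - dot (v y) d.
  by rewrite -dotBl sqr_norm_le_dot.
rewrite distrC in xy *.
rewrite -ler_sqr ?nnegrE ?normr_ge0 ?(mulr_ge0, ltW c0) //.
have {xz yz xy} key : t * `|d| ^+ 2 <= c * (t * `|d|) ^+ 2 + c * `|x - y| ^+ 2.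
  by have := ler_wpM2l (ltW t0) dd; lra.
have -> : `|d| ^+ 2 = (4 * c) * (t * `|d| ^+ 2 - c * (t * `|d|) ^+ 2).
  by rewrite /t; field; rewrite gt_eqF.
have -> : (2 * c * `|x - y|) ^+ 2 = (4 * c) * (c * `|x - y| ^+ 2) by ring.
by rewrite ler_pM2l ?mulr_gt0 //; lra.
Qed.

Lemma quad_tangent_C1 (R : realType) (n : nat) (f : 'rV[R]_n -> R)
    (v : 'rV[R]_n -> 'rV[R]_n) (c : R) : 0 < c ->
  (forall x, quad_tangent c f x (v x)) ->
  C1 f.
Proof.
move=> c0 pf; split; first by move=> x; case: (quad_tangent_grad c0 (pf x)).
have -> : grad f = v.
  by apply/funext => x; case: (quad_tangent_grad c0 (pf x)).
apply: (@lipschitz_continuous _ _ _ _ (2 * c)).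
exact: quad_tangent_lipschitz pf.
Qed.

Lemma quad_tangent_continuous (R : realType) (n : nat) (f : 'rV[R]_n -> R)
    (v : 'rV[R]_n -> 'rV[R]_n) (c : R) : 0 < c ->
  (forall x, quad_tangent c f x (v x)) ->
  continuous f.
Proof.
move=> c0 pf x; apply: differentiable_continuous.
by case: (quad_tangent_grad c0 (pf x)).
Qed.

(** * Infimal convolution of a convex function with a smooth kernel *)

(** The form in which 1-coercivity is used: the bound on a quotient is
    replaced by affine bounds, which hold for every [z] and scale well. *)
Definition superlinear (R : realType) (n : nat) (h : 'rV[R]_n -> R) : Prop :=
  forall A, exists B, forall z, A * `|z| - B <= h z.

(** On a ball around a point of its domain [g] is bounded below by compactness;
    convexity along the segments that leave the ball turns this into a linear
    bound outside.  This bound plays the part of an affine minorant, whose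
    existence rests on a separation theorem. *)
Lemma econvex_lsc_ge_affine_norm (R : realType) (n : nat)
    (g : 'rV[R]_n -> \bar R) :
  (forall x, g x != -oo%E) -> dom g !=set0 -> lower_semicontinuous g ->
  econvex g ->
  exists m D : R, 0 <= D /\ forall u, ((m - D * `|u|)%:E <= g u)%E.
Proof.
move=> gNy [x0 gx0] glsc gcvx.
have cK := @compact_closed_ball_rV R n x0 1.
have K0 : closed_ball_ Num.norm x0 1 x0.
  by rewrite /closed_ball_ /= subrr normr0.
have [p Kp minp] := lsc_argmin_compact glsc cK (ex_intro _ x0 K0).
have fx0 : g x0 \is a fin_num by rewrite fin_numE gNy -ltey.
have fp : g p \is a fin_num.
  by rewrite fin_numE gNy -ltey (le_lt_trans (minp _ K0)).
set m := fine (g p); set b := fine (g x0).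
have mb : m <= b by rewrite -lee_fin !fineK // minp.
exists (m - (b - m) * `|x0|), (b - m); split; first by rewrite subr_ge0.
move=> u; apply: (@le_trans _ _ (m - (b - m) * `|u - x0|)%:E).
  rewrite lee_fin; have := ler_normB u x0.
  by rewrite -subr_ge0 in mb; move=> /(ler_wpM2l mb); lra.
have [ux0|ux0] := leP `|x0 - u| 1.
  apply: le_trans (minp u ux0); rewrite -(fineK fp) lee_fin.
  by rewrite gerBl mulr_ge0 // subr_ge0.
rewrite distrC in ux0; set d := `|u - x0| in ux0 *.
have d0 : 0 < d by exact: lt_trans ux0.
have [->|gu] := eqVneq (g u) +oo%E; first exact: leey.
have fu : g u \is a fin_num by rewrite fin_numE gNy gu.
have t01 : 0 <= d^-1 <= 1 by rewrite invr_ge0 ltW //= invf_le1 // ltW.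
have := gcvx u x0 _ t01.
have Kw : closed_ball_ Num.norm x0 1 (d^-1 *: u + (1 - d^-1) *: x0).
  rewrite /closed_ball_ /= distrC.
  have -> : d^-1 *: u + (1 - d^-1) *: x0 - x0 = d^-1 *: (u - x0).
    by apply/rowP => i; rewrite !mxE; ring.
  by rewrite normrZ gtr0_norm ?invr_gt0 // -/d mulVf // gt_eqF.
move=> /(le_trans (minp _ Kw)).
rewrite -(fineK fu) -(fineK fp) -(fineK fx0) -!EFinM -EFinD !lee_fin.
rewrite -/b -/m => /(ler_wpM2l (ltW d0)).
rewrite mulrDr mulVKf ?gt_eqF // mulrA mulrBr mulr1 divff ?gt_eqF //.
by nra.
Qed.

Section infconv.
Variables (R : realType) (n : nat).
Variables (g : 'rV[R]_n -> \bar R) (h : 'rV[R]_n -> R).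
Variables (w : 'rV[R]_n -> 'rV[R]_n) (c : R).
Hypothesis g_gtNy : forall x, g x != -oo%E.
Hypothesis c_gt0 : 0 < c.
Hypothesis h_quad : forall x, quad_tangent c h x (w x).

Lemma subdiff_fin_num u v : subdiff g u v -> g u \is a fin_num.
Proof. by case=> gu _; rewrite fin_numE g_gtNy -ltey. Qed.

Lemma infconv_le x u : (infconv g (EFin \o h) x <= g u + (h (x - u))%:E)%E.
Proof. by apply: ereal_inf_lbound; exists u. Qed.

(** Add the subgradient inequality of [g] at [u] to that of [h] at [x - u]: as
    the slope is the same, the intermediate point [z] of the infimal
    convolution cancels. *)
Lemma infconv_ge_tangent x u y : subdiff g u (w (x - u)) ->
  (g u + (h (x - u) + dot (w (x - u)) (y - x))%:E <= infconv g (EFin \o h) y)%E.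
Proof.
move=> gu; have fu := subdiff_fin_num gu; case: gu => _ gu.
apply: le_ereal_inf_tmp => _ [z _ <-] /=.
have [->|gz] := eqVneq (g z) +oo%E; first by rewrite addye ?leey.
have fz : g z \is a fin_num by rewrite fin_numE g_gtNy gz.
have := gu z; have /andP[+ _] := h_quad (x - u) (y - z).
rewrite -(fineK fu) -(fineK fz) -!EFinD !lee_fin => hz gzu.
have -> : y - x = (z - u) + (y - z - (x - u)).
  by apply/rowP => i; rewrite !mxE; ring.
by rewrite dotDr; lra.
Qed.

Lemma infconv_eq x u : subdiff g u (w (x - u)) ->
  infconv g (EFin \o h) x = (g u + (h (x - u))%:E)%E.
Proof.
move=> gu; apply/eqP; rewrite eq_le infconv_le /=.
have := infconv_ge_tangent x gu.
by rewrite subrr -[X in dot _ X](scale0r 0) dotZr mul0r addr0.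
Qed.

(** The first-order optimality condition.  Minimality is compared at a point
    [z] at parameter [t] on the segment from [u] to [y], where [g] is bounded
    by convexity and [h] by its quadratic tangent; after division by [t] the
    error is [t * K], and [t] tends to zero. *)
Lemma argmin_subdiff x u : econvex g -> dom g !=set0 ->
  (forall y, g u + (h (x - u))%:E <= g y + (h (x - y))%:E)%E ->
  subdiff g u (w (x - u)).
Proof.
move=> gcvx [x0 gx0] minu.
have gu : g u != +oo%E.
  apply/eqP => guy; have := minu x0; rewrite guy addye // leye_eq.
  by apply/negP; rewrite -ltey lte_add_pinfty // ltry.
split; first by rewrite /dom /= ltey.
have fu : g u \is a fin_num by rewrite fin_numE g_gtNy gu.
move=> y; have [->|gy] := eqVneq (g y) +oo%E; first exact: leey.
have fy : g y \is a fin_num by rewrite fin_numE g_gtNy gy.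
rewrite -(fineK fu) -(fineK fy) -EFinD lee_fin.
apply/ler_addgt0Pr => e e0.
set K := c * `|y - u| ^+ 2.
have K0 : 0 <= K by apply: mulr_ge0; [exact: ltW | exact: exprn_ge0].
have Ke : 0 < K + e by rewrite ltr_wpDl.
pose t := e / (K + e).
have t0 : 0 < t by rewrite divr_gt0.
have tK : t * K <= e.
  by rewrite /t mulrAC ler_pdivrMr // ler_pM2l // lerDl ltW.
have t01 : 0 <= t <= 1 by rewrite ltW //= ler_pdivrMr // mul1r lerDr.
set z := t *: y + (1 - t) *: u.
have xz : x - z - (x - u) = - t *: (y - u).
  by apply/rowP => i; rewrite !mxE; ring.
have /andP[_] := h_quad (x - u) (x - z).
rewrite xz dotZr normrZ normrN gtr0_norm // => hz.
have := le_trans (minu z) (leeD2r _ (gcvx y u t t01)).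
rewrite -(fineK fu) -(fineK fy) -!EFinM -!EFinD lee_fin => gz.
rewrite -(ler_pM2l t0); have := ler_wpM2l (ltW t0) tK.
by rewrite /K in hz *; nra.
Qed.

(** The infimal convolution inherits a quadratic tangent from [h]: the lower
    bound is [infconv_ge_tangent], the upper one comes from the competitor [u]
    that is optimal at [x]. *)
Lemma infconv_quad_tangent x u : subdiff g u (w (x - u)) ->
  (forall y, infconv g (EFin \o h) y \is a fin_num) ->
  quad_tangent c (fun y => fine (infconv g (EFin \o h) y)) x (w (x - u)).
Proof.
move=> gu fs y; have fsy := fs y; have fu := subdiff_fin_num gu.
have := infconv_ge_tangent y gu; have := infconv_le y u.
have /andP[_] := h_quad (x - u) (y - u).
rewrite (infconv_eq gu) -(fineK fu) -(fineK fsy) -!EFinD !lee_fin /=.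
by rewrite opprB addrA subrK => *; apply/andP; split; lra.
Qed.
End infconv.

(** The superlinear [h] dominates the at most linear decrease of [g], so the
    objective is coercive. *)
Lemma infconv_argmin (R : realType) (n : nat) (g : 'rV[R]_n -> \bar R)
    (h : 'rV[R]_n -> R) (x : 'rV[R]_n) :
  (forall x, g x != -oo%E) -> dom g !=set0 -> lower_semicontinuous g ->
  econvex g -> continuous h ->
  superlinear h ->
  exists u, forall y, (g u + (h (x - u))%:E <= g y + (h (x - y))%:E)%E.
Proof.
move=> gNy gdom glsc gcvx ch hsup.
have [m [D [D0 gmD]]] := econvex_lsc_ge_affine_norm gNy gdom glsc gcvx.
have [x0 gx0] := gdom.
have fx0 : g x0 \is a fin_num by rewrite fin_numE gNy -ltey.
have [B hB] := hsup (D + 1).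
pose r := fine (g x0) + h (x - x0) - m + B + (D + 1) * `|x|.
apply: (@lsc_argmin _ _ (fun y => (g y + (h (x - y))%:E)%E) x0 r).
  have cB : continuous (fun y : 'rV[R]_n => x - y).
    apply: (@lipschitz_continuous _ _ _ _ 1) => y z.
    by rewrite mul1r opprB addrC addrA subrK distrC.
  by apply: lsc_addr => // y; apply: continuous_comp; [exact: cB | exact: ch].
move=> y ry; apply: le_trans (leeD2r _ (gmD y)).
rewrite -(fineK fx0) -!EFinD lee_fin.
have := hB (x - y); have : `|y| - `|x| <= `|x - y| by rewrite distrC lerB_dist.
move=> /(ler_wpM2l (addr_ge0 D0 ler01)).
by rewrite /r in ry; nra.
Qed.

(** * The kernel and its epigraphical scalings *)

Section kernel.
Variables (R : realType) (n : nat) (om : 'rV[R]_n -> R).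
Hypothesis om_convex : convex_function [set: 'rV[R]_n] om.
Hypothesis om_C1 : C1 om.

(** The tangent inequality at [y] gives
    [om y - om x <= dot (grad om y) (y - x)], and replacing [grad om y] by
    [grad om x] costs at most a quadratic term. *)
Lemma lipschitz_grad_quad_tangent : lipschitz_grad om ->
  exists2 c, 0 < c & forall x, quad_tangent c om x (grad om x).
Proof.
move=> [L omL]; have [diff_om _] := om_C1.
have tangent x y := convex_ge_tangent y om_convex (diff_om x).
pose k := `|L| * Num.sqrt n%:R; have k0 : 0 <= k by rewrite mulr_ge0 ?sqrtr_ge0.
exists (n%:R * k + 1); first by rewrite ltr_wpDl ?mulr_ge0.
move=> x y; have xy := tangent x y; have yx := tangent y x.
apply/andP; split; first by lra.
have gxy : `|grad om y - grad om x| <= k * `|y - x|.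
  apply: le_trans (norm_le_enorm _) _; apply: le_trans (omL _ _) _.
  rewrite -mulrA; apply: le_trans (ler_wpM2r (sqrtr_ge0 _) (ler_norm L)) _.
  by rewrite ler_wpM2l // enorm_le_norm.
have := le_trans (ler_norm _) (dot_le_norm (grad om y - grad om x) (y - x)).
rewrite dotBl -[x - y]opprB dotC dotNl dotC in yx *.
have := ler_wpM2l (mulr_ge0 (ler0n R n) (normr_ge0 (y - x))) gxy.
have := sqr_ge0 `|y - x|.
by nra.
Qed.

(** Coercivity bounds [om] outside a ball, and the tangent at the origin bounds
    it inside. *)
Lemma coercive_superlinear : one_coercive om -> superlinear om.
Proof.
move=> omc A; have [diff_om _] := om_C1.
have [r omr] := omc `|A|.
set q := n%:R * `|grad om 0|.
pose s := Num.max r 0; have s0 : 0 <= s by rewrite le_max lexx orbT.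
exists ((`|A| + q) * s + `|om 0|) => z.
have q0 : 0 <= q by rewrite mulr_ge0.
have Az : A * `|z| <= `|A| * `|z| by rewrite ler_wpM2r // ler_norm.
have [zs|sz] := leP (enorm z) s.
  have := convex_ge_tangent z om_convex (diff_om 0); rewrite subr0.
  have := dot_le_norm (grad om 0) z; rewrite ler_norml => /andP[+ _].
  have := le_trans (norm_le_enorm z) zs.
  have := ler_norm (- om 0); rewrite normrN -/q.
  by move: (normr_ge0 A) => *; nra.
have z0 : 0 < enorm z by exact: le_lt_trans sz.
have := omr z; rewrite (le_lt_trans _ sz) ?le_max ?lexx // ltr_pdivlMr //.
move=> /(_ isT).
have := ler_wpM2l (normr_ge0 A) (norm_le_enorm z).
have : 0 <= (`|A| + q) * s by rewrite mulr_ge0 ?addr_ge0.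
by have := normr_ge0 (om 0); lra.
Qed.
End kernel.

(** The function [f - dot v] is still superlinear, and at a minimizer [p] of it
    the slope [w p - v] vanishes: otherwise a short step against it would
    decrease the function, by the quadratic upper bound. *)
Lemma superlinear_grad_surj (R : realType) (n : nat) (f : 'rV[R]_n -> R)
    (w : 'rV[R]_n -> 'rV[R]_n) (c : R) : 0 < c ->
  (forall x, quad_tangent c f x (w x)) ->
  superlinear f ->
  forall v, exists z, w z = v.
Proof.
move=> c0 pf fsup v; have cf := quad_tangent_continuous c0 pf.
have [B fB] := fsup (n%:R * `|v| + 1).
(* [0%E +] gives the tilted function the shape that [lsc_addr] expects. *)
have [p minp] : exists p, forall z,
    (0%E + (f p - dot v p)%:E <= 0%E + (f z - dot v z)%:E)%E.
  apply: (@lsc_argmin _ _ _ 0 (f 0 + B)).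
    apply: lsc_addr; first by move=> x a a0; exists setT => //; exact: filterT.
    move=> x; apply: (@cvgB _ _ _ _ _ f (dot v)); first exact: nbhs_filter.
      exact: cf.
    exact: dot_continuous.
  move=> z rz; rewrite !add0e lee_fin -(scale0r 0) dotZr mul0r subr0 scale0r.
  have := fB z; have := le_trans (ler_norm _) (dot_le_norm v z).
  by lra.
exists p; set d := w p - v; pose t := (2 * c)^-1.
have t0 : 0 < t by rewrite invr_gt0 mulr_gt0.
have := minp (p - t *: d); rewrite !add0e lee_fin dotBr dotZr.
have /andP[_] := pf p (p - t *: d).
rewrite [_ - p]addrC addKr -scaleNr dotZr normrZ normrN gtr0_norm //.
have := sqr_norm_le_dot d.
rewrite {2}/d dotBl => /(ler_wpM2l (ltW t0)) dd h1 h2.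
have : t * `|d| ^+ 2 <= c * (t * `|d|) ^+ 2 by lra.
have -> : c * (t * `|d|) ^+ 2 = 2^-1 * (t * `|d| ^+ 2).
  by rewrite /t; field; rewrite gt_eqF.
move=> td; have : t * `|d| ^+ 2 <= 0 by lra.
rewrite pmulr_rle0 // => d2.
have /eqP : `|d| ^+ 2 = 0 by apply/eqP; rewrite eq_le d2 sqr_ge0.
by rewrite expf_eq0 /= normr_eq0 subr_eq0 => /eqP.
Qed.

Section scaling.
Variables (R : realType) (n : nat) (om : 'rV[R]_n -> R) (mu : R).
Hypothesis mu0 : 0 < mu.

Lemma epi_scale_quad_tangent (w : 'rV[R]_n -> 'rV[R]_n) (c : R) :
  (forall x, quad_tangent c om x (w x)) ->
  forall x, quad_tangent (c / mu) (epi_scale om mu) x (w (mu^-1 *: x)).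
Proof.
move=> pf x y; have := pf (mu^-1 *: x) (mu^-1 *: y).
rewrite -scalerBr dotZr normrZ gtr0_norm ?invr_gt0 //.
set a := dot _ _; rewrite /epi_scale.
have -> : mu * om (mu^-1 *: y) - mu * om (mu^-1 *: x) - a
  = mu * (om (mu^-1 *: y) - om (mu^-1 *: x) - mu^-1 * a).
  by field; rewrite gt_eqF.
have -> : c / mu * `|y - x| ^+ 2 = mu * (c * (mu^-1 * `|y - x|) ^+ 2).
  by field; rewrite gt_eqF.
by move=> /andP[p0 pc]; rewrite ler_pM2l // pc andbT mulr_ge0 // ltW.
Qed.

Lemma epi_scale_superlinear A B : (forall z, A * `|z| - B <= om z) ->
  forall z, A * `|z| - mu * B <= epi_scale om mu z.
Proof.
move=> omAB z; have := omAB (mu^-1 *: z).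
rewrite normrZ gtr0_norm ?invr_gt0 // => /(ler_wpM2l (ltW mu0)).
by rewrite mulrBr mulrCA mulVKf ?gt_eqF.
Qed.

End scaling.

(** * Convergence of the smoothing and of its gradients *)

Lemma limn_einf_ge (R : realType) (u : nat -> \bar R) (a : \bar R) :
  (\forall k \near \oo, (a <= u k)%E) -> (a <= limn_einf u)%E.
Proof.
move=> [N _ au]; rewrite limn_einf_lim.
apply: lime_ge; first exact: is_cvg_einfs.
exists N => // m /= Nm; apply: le_ereal_inf_tmp => _ [k /= mk <-].
by apply: au => /=; exact: leq_trans mk.
Qed.

Lemma limn_esup_le (R : realType) (u : nat -> \bar R) (a : \bar R) :
  (\forall k \near \oo, (u k <= a)%E) -> (limn_esup u <= a)%E.
Proof.
move=> ua; rewrite -leeN2 -limn_einfN; apply: limn_einf_ge.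
by apply: filterS ua => k /=; rewrite leeN2.
Qed.

Section smoothing.
Variables (R : realType) (n : nat).
Variables (g : 'rV[R]_n -> \bar R) (om : 'rV[R]_n -> R).
Variables (w : 'rV[R]_n -> 'rV[R]_n) (c : R).
Hypothesis g_gtNy : forall x, g x != -oo%E.
Hypothesis g_proper : dom g !=set0.
Hypothesis g_lsc : lower_semicontinuous g.
Hypothesis g_convex : econvex g.
Hypothesis c_gt0 : 0 < c.
Hypothesis om_quad : forall x, quad_tangent c om x (w x).
Hypothesis om_superlinear : superlinear om.

Local Notation s := (infconv_smoothing g om).

Lemma smoothing_prox mu x : 0 < mu ->
  exists u, subdiff g u (w (mu^-1 *: (x - u))).
Proof.
move=> mu0; have hp := epi_scale_quad_tangent mu0 om_quad.
have cmu : 0 < c / mu by rewrite divr_gt0.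
have [|u minu] := @infconv_argmin _ _ g (epi_scale om mu) x g_gtNy g_proper
    g_lsc g_convex (quad_tangent_continuous cmu hp).
  move=> A; have [B omB] := om_superlinear A; exists (mu * B).
  exact: epi_scale_superlinear.
exists u; exact: (argmin_subdiff g_gtNy cmu hp g_convex g_proper minu).
Qed.

Lemma smoothing_fin_num mu x : 0 < mu -> s x mu \is a fin_num.
Proof.
move=> mu0; have [u gu] := smoothing_prox x mu0.
have hq := epi_scale_quad_tangent mu0 om_quad.
rewrite /infconv_smoothing (infconv_eq g_gtNy hq gu).
by rewrite fin_numD (subdiff_fin_num g_gtNy gu).
Qed.

Lemma smoothing_grad mu x u : 0 < mu -> subdiff g u (w (mu^-1 *: (x - u))) ->
  grad_x s x mu = w (mu^-1 *: (x - u)).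
Proof.
move=> mu0 gu; have cmu : 0 < c / mu by rewrite divr_gt0.
have pf := infconv_quad_tangent g_gtNy (epi_scale_quad_tangent mu0 om_quad) gu
  (fun y => smoothing_fin_num y mu0).
by case: (quad_tangent_grad cmu pf).
Qed.

Lemma smoothing_C1 mu : 0 < mu -> C1 (fun x => fine (s x mu)).
Proof.
move=> mu0; have cmu : 0 < c / mu by rewrite divr_gt0.
pose U x := projT1 (cid (smoothing_prox x mu0)).
apply: (@quad_tangent_C1 _ _ _ (fun x => w (mu^-1 *: (x - U x))) (c / mu) cmu).
move=> x; have gU := projT2 (cid (smoothing_prox x mu0)).
have hq := epi_scale_quad_tangent mu0 om_quad.
exact: (infconv_quad_tangent g_gtNy hq gU (fun y => smoothing_fin_num y mu0)).
Qed.

(** The bound behind epi-convergence.  A point [z] close to [x] contributes at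
    least [a] by semicontinuity.  For a far point the kernel contributes
    [A * `|y - z|] up to the vanishing term [mu * B], and [A] is chosen large
    enough to make up for the linear decrease of [g]. *)
Lemma smoothing_lower x a : (a%:E < g x)%E ->
  exists2 d, 0 < d & exists B, forall y mu, `|y - x| < d -> 0 < mu ->
    ((a - mu * B)%:E <= s y mu)%E.
Proof.
move=> /g_lsc[V /nbhs_normP[r /= r0 rV] gV].
have [m [D [D0 gmD]]] :=
  econvex_lsc_ge_affine_norm g_gtNy g_proper g_lsc g_convex.
exists (r / 2); first exact: divr_gt0.
(* The excess of [A] over [D], over a distance of at least [r / 2], has to
   make up for the deficit [a - m + D * (`|x| + r)]. *)
pose A := D + `|a - m + D * (`|x| + r)| / (r / 2).
have r20 : 0 < r / 2 by rewrite divr_gt0.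
have A0 : 0 <= A by rewrite addr_ge0 // divr_ge0 // ltW.
have [B omB] := om_superlinear A.
exists B => y mu yx mu0; apply: le_ereal_inf_tmp => _ [z _ <-] /=.
have hz := epi_scale_superlinear mu0 omB (y - z).
have [xz|xz] := ltP `|x - z| r.
  have := ltW (gV z (rV z xz)); have [gz|gz] := eqVneq (g z) +oo%E.
    by rewrite gz addye ?leey.
  have fz : g z \is a fin_num by rewrite fin_numE g_gtNy gz.
  rewrite -(fineK fz) -EFinD !lee_fin => az.
  by have := mulr_ge0 A0 (normr_ge0 (y - z)); lra.
apply: le_trans (leeD2r _ (gmD z)); rewrite -EFinD lee_fin.
set q := `|a - m + D * (`|x| + r)| in A A0 omB hz *.
have qA : A * (r / 2) = D * (r / 2) + q.
  by rewrite /A mulrDl divfK // gt_eqF.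
have yz : r / 2 <= `|y - z|.
  by have := ler_distD y x z; rewrite (distrC x y); lra.
have zy : `|z| <= `|x| + r / 2 + `|y - z|.
  have zE : z = x + (y - x) - (y - z) by rewrite subrKC subKr.
  rewrite {1}zE; apply: le_trans (ler_normB _ _) _; rewrite lerD2r.
  by apply: le_trans (ler_normD x (y - x)) _; rewrite lerD2l ltW.
have := ler_norm (a - m + D * (`|x| + r)); rewrite -/q.
have := ler_wpM2l D0 zy.
have q0 : 0 <= q by exact: normr_ge0.
have AD : 0 <= A - D by rewrite subr_ge0 lerDl divr_ge0 // ltW.
have := ler_wpM2l AD yz.
by nra.
Qed.

Lemma smoothing_epi_cvg mu : downto0 mu -> epi_cvg (fun k x => s x (mu k)) g.
Proof.
move=> [mu0 mucv] x; split.
  move=> y yx; rewrite leNgt; apply/negP => /ereal_lt_between[b /andP[lb bg]].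
  have [a /andP[ba ag]] := ereal_lt_between bg; rewrite lte_fin in ba.
  have [d d0 [B sB]] := smoothing_lower ag.
  suff : (b%:E <= limn_einf (fun k => s (y k) (mu k)))%E by rewrite leNgt lb.
  apply: limn_einf_ge.
  have muB : mu k * B @[k --> \oo] --> (0 : R).
    by rewrite -(mul0r B); apply: cvgM; [exact: mucv | exact: cvg_cst].
  have ab : 0 < a - b by rewrite subr_gt0.
  near=> k; apply: le_trans (sB (y k) (mu k) _ (mu0 k)); last first.
    by rewrite distrC; near: k; move/cvgrPdist_lt : yx; exact.
  rewrite lee_fin lerBrDr -lerBrDl; apply: le_trans (ler_norm _) _.
  rewrite -[X in `|X|]opprK normrN -[- _]sub0r; near: k.
  by move/cvgrPdist_le : muB; exact.
exists (fun=> x); split; first exact: cvg_cst.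
have [gx|gx] := eqVneq (g x) +oo%E; first by rewrite gx leey.
have fx : g x \is a fin_num by rewrite fin_numE g_gtNy gx.
apply/lee_addgt0Pr => e e0; apply: limn_esup_le.
have muB : mu k * om 0 @[k --> \oo] --> (0 : R).
  by rewrite -(mul0r (om 0)); apply: cvgM; [exact: mucv | exact: cvg_cst].
near=> k; apply: le_trans (infconv_le _ _ x x) _.
rewrite subrr /epi_scale scaler0 leeD2l // lee_fin.
apply: le_trans (ler_norm _) _.
rewrite -[X in `|X|]opprK normrN -[- _]sub0r; near: k.
by move/cvgrPdist_le : muB; exact.
Unshelve. all: by end_near. Qed.

(** Inverse images of bounded sets under the gradient of a superlinear function
    are bounded: the tangent at [z], evaluated at the origin, lies below
    [om 0]. *)
Lemma superlinear_grad_bounded V :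
  exists M, forall z, `|w z| <= V -> `|z| <= M.
Proof.
have [B omB] := om_superlinear (n%:R * V + 1).
exists (om 0 + B) => z wV.
have /andP[+ _] := om_quad z 0; rewrite sub0r -[- z]scaleN1r dotZr mulN1r.
have := le_trans (ler_norm _) (dot_le_norm (w z) z); have := omB z.
have := ler_wpM2r (normr_ge0 z) (ler_wpM2l (ler0n R n) wV).
by lra.
Qed.

(** The gradient at [y] is a subgradient of [g] at a point [u] such that
    [y - u = mu *: zu], where [w zu] is that gradient.  Gradients close to [v]
    keep [zu] bounded, hence [u] is close to [x] when [mu] is small, and the
    subgradient inequality at [u] passes to [x] by semicontinuity of [g]. *)
Lemma smoothing_grad_outer x v :
  (forall d, 0 < d -> exists y mu,
     [/\ `|y - x| < d, `|grad_x s y mu - v| < d & 0 < mu < d]) ->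
  subdiff g x v.
Proof.
move=> xv.
have ineq z : (g x + (dot v (z - x))%:E <= g z)%E.
  have [->|gz] := eqVneq (g z) +oo%E; first exact: leey.
  have fz : g z \is a fin_num by rewrite fin_numE g_gtNy gz.
  rewrite -leeBrDr // leNgt; apply/negP => /ereal_lt_between[a /andP[za ag]].
  have [V /nbhs_normP[r /= r0 rV] gV] := g_lsc ag.
  have [M wM] := superlinear_grad_bounded (`|v| + 1).
  rewrite -(fineK fz) -EFinB lte_fin in za.
  set e := a - (fine (g z) - dot v (z - x)).
  have e0 : 0 < e by rewrite subr_gt0.
  (* [`|x - u| < d * N], and [d * K] bounds the error made by replacing the
     affine minorant of slope [v'] at [u] by the one of slope [v] at [x]. *)
  pose N := 1 + `|M|; have N0 : 0 < N by rewrite ltr_pwDl.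
  pose K := n%:R * (`|z - x| + N) + n%:R * `|v| * N.
  have K0 : 0 <= K by rewrite addr_ge0 ?mulr_ge0 ?addr_ge0 // ltW.
  have K1 : 0 < K + 1 by rewrite ltr_wpDl.
  pose d := Num.min 1 (Num.min (r / N) (e / (K + 1))).
  have d0 : 0 < d by rewrite !lt_min ltr01 !divr_gt0.
  have d1 : d <= 1 by rewrite /d ge_min lexx.
  have dr : d * N <= r by rewrite -ler_pdivlMr // /d !ge_min lexx orbT.
  have de : d * (K + 1) <= e by rewrite -ler_pdivlMr // /d !ge_min lexx !orbT.
  have [y [mu [yx vd /andP[mu0 mud]]]] := xv d d0.
  have [u gu] := smoothing_prox y mu0.
  rewrite (smoothing_grad mu0 gu) in vd.
  set zu := mu^-1 *: (y - u) in gu vd; set v' := w zu in gu vd.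
  have zM : `|zu| <= `|M|.
    apply: le_trans (ler_norm M); apply: wM.
    rewrite -/v' -[v'](subrKC v); apply: le_trans (ler_normD _ _) _.
    by rewrite lerD2l ltW // (lt_le_trans vd).
  have ux : `|x - u| < d * N.
    have -> : x - u = - (y - x) + mu *: zu.
      by rewrite scalerA divff ?gt_eqF // scale1r opprB addrA subrK.
    apply: le_lt_trans (ler_normD _ _) _; rewrite normrN normrZ gtr0_norm //.
    rewrite /N mulrDr mulr1 ltr_leD //.
    by rewrite ler_pM // ltW.
  have := ltW (gV u (rV u (lt_le_trans ux dr))).
  have fu := subdiff_fin_num g_gtNy gu; have [_ /(_ z)] := gu.
  rewrite -(fineK fu) -(fineK fz) -EFinD !lee_fin => gzu ag'.
  have h1 := dot_le_norm (v' - v) (z - u); have h2 := dot_le_norm v (x - u).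
  have h0 : dot v' (z - u)
      = dot v (z - x) + dot (v' - v) (z - u) + dot v (x - u).
    by rewrite !(dotBl, dotBr); ring.
  have zu' : `|z - u| <= `|z - x| + N.
    apply: le_trans (ler_distD x z u) _; rewrite lerD2l.
    by apply: ltW; apply: lt_le_trans ux _; rewrite ler_piMl // ltW.
  have h3 : n%:R * `|v' - v| * `|z - u| <= n%:R * d * (`|z - x| + N).
    by apply: ler_pM => //; rewrite ?mulr_ge0 // ler_wpM2l // ltW.
  have h4 : n%:R * `|v| * `|x - u| <= n%:R * `|v| * (d * N).
    by rewrite ler_wpM2l ?mulr_ge0 // ltW.
  move: h1 h2; rewrite !ler_norml => /andP[h1 _] /andP[h2 _].
  have dK : n%:R * d * (`|z - x| + N) + n%:R * `|v| * (d * N) = d * K.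
    by rewrite /K; ring.
  rewrite /e in de; suff : a < a by rewrite ltxx.
  by lra.
split => //; have [x0 gx0] := g_proper.
have := le_lt_trans (ineq x0) gx0.
by rewrite /dom /= !ltey; apply: contra => /eqP ->; rewrite addye.
Qed.

(** For [z] with [w z = v], the point [x] is optimal for [x + mu *: z], where
    the gradient is therefore exactly [v], for every [mu]. *)
Lemma smoothing_grad_inner x v : subdiff g x v ->
  exists z, forall mu, 0 < mu -> grad_x s (x + mu *: z) mu = v.
Proof.
move=> gx.
have [z wz] := superlinear_grad_surj c_gt0 om_quad om_superlinear v.
exists z => mu mu0.
have zE : mu^-1 *: (x + mu *: z - x) = z.
  by rewrite addrC addKr scalerA mulVf ?gt_eqF // scale1r.
by have := @smoothing_grad mu (x + mu *: z) x mu0; rewrite zE wz; exact.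
Qed.

Lemma smoothing_pk_cvg :
  pk_cvg (fun mu => gph (fun x => [set grad_x s x mu])) (gph (subdiff g)).
Proof.
move=> mu [mu0 mucv]; split.
  move=> phi z phii zC [x v] clz; apply: smoothing_grad_outer => d d0.
  have phik k : (k <= phi k)%N.
    elim: k => // k IH; apply: leq_ltn_trans IH _.
    suff : (phi k < phi k.+1)%O by [].
    by rewrite ltNge phii -ltnNge.
  have [N _ muN] : \forall k \near \oo, `|0 - mu k| < d.
    by move/cvgrPdist_lt : mucv; exact.
  have A : (z @ \oo) [set p | exists2 k, (N <= k)%N & p = z k].
    by exists N => // k /= Nk; exists k.
  have [_ [[k Nk ->] []]] := clz _ _ A (nbhsx_ballx (x, v) d d0).
  rewrite -!ball_normE /= => xz vz.
  exists (z k).1, (mu (phi k)); have /= <- := zC k.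
  rewrite mu0 distrC xz distrC vz; split => //.
  have := muN (phi k) (leq_trans Nk (phik k)); rewrite sub0r normrN.
  exact: le_lt_trans (ler_norm _).
move=> [x v] gxv; have [z zv] := @smoothing_grad_inner x v gxv.
exists (fun k => (x + mu k *: z, v)).
split; first by move=> k; rewrite /gph /= zv.
have xz : x + mu k *: z @[k --> \oo] --> x.
  rewrite -[X in _ --> X]addr0 -(scale0r z); apply: cvgD; first exact: cvg_cst.
  by apply: cvgZr_tmp.
exact: cvg_pair xz (cvg_cst v).
Qed.
End smoothing.

(** The outer limit of the gradients at [x] is the section at [x] of the limit
    of their graphs, because a convergent sequence clusters at its limit and one
    sequence of parameters, such as the harmonic one, suffices for the
    converse. *)
Lemma Limsup_grad_pk_cvg (R : realType) (n : nat)
    (s : 'rV[R]_n -> R -> \bar R) (S : 'rV[R]_n -> set 'rV[R]_n) :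
  pk_cvg (fun mu => gph (fun x => [set grad_x s x mu])) (gph S) ->
  forall x, Limsup_grad s x = S x.
Proof.
move=> sS x; apply/seteqP; split=> v.
  move=> [y [mu [yx mu0 yv]]].
  have [+ _] := sS mu mu0.
  move=> /(_ id (fun k => (y k, grad_x s (y k) (mu k)))).
  move=> /(_ (fun _ _ => erefl) (fun _ => erefl) (x, v)); apply.
  have yyv := cvg_pair yx yv.
  by move=> A B yA /yyv yB; exact: filter_ex (filterI yA yB).
move=> Sxv; pose mu k : R := k.+1%:R^-1.
have mu0 : downto0 mu.
  by split; [move=> k; rewrite invr_gt0 | exact: cvg_harmonic].
have [_ /(_ (x, v) Sxv)[z [zS zxv]]] := sS mu mu0.
exists (fst \o z), mu; split => //.
  exact: (cvg_comp _ _ zxv cvg_fst).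
under eq_fun do rewrite -zS.
exact: (cvg_comp _ _ zxv cvg_snd).
Qed.

Theorem theorem4p6 (R : realType) (n : nat)
    (g : 'rV[R]_n -> \bar R) (om : 'rV[R]_n -> R)
    (g_gtNy : forall x, g x != -oo%E)
    (g_proper : dom g !=set0)
    (g_lsc : lower_semicontinuous g)
    (g_convex : econvex g)
    (om_convex : convex_function [set: 'rV[R]_n] om)
    (om_C1 : C1 om)
    (om_lipschitz_grad : lipschitz_grad om)
    (om_coercive : one_coercive om) :
  let s_g := infconv_smoothing g om in
  [/\ epi_smoothing g s_g,
      pk_cvg (fun mu => gph (fun x => [set grad_x s_g x mu])) (gph (subdiff g))
    & forall xbar, dom g xbar -> Limsup_grad s_g xbar = subdiff g xbar].
Proof.
move=> s_g.
have [c c0 omp] :=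
  lipschitz_grad_quad_tangent om_convex om_C1 om_lipschitz_grad.
have oms := coercive_superlinear om_convex om_C1 om_coercive.
have pk := smoothing_pk_cvg g_gtNy g_proper g_lsc g_convex c0 omp oms.
split => //; last by move=> x _; exact: Limsup_grad_pk_cvg.
split; first by move=> mu; exact: smoothing_epi_cvg.
move=> mu mu0; split; last exact: smoothing_C1 omp oms _ mu0.
by move=> x; exact: smoothing_fin_num omp oms _ _ mu0.
Qed.
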